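(* Let $m$ be a nonnegative integer and $0<q<1$. Then $$\left(\sum_{n=-\infty}^\infty(-1)^nq^{n^2}\right)^{m+1}=1+\sum_{n=1}^\infty(-1)^n(1+q^n)q^{n(n-1)/2}\;{}_{m+2}\phi_{m+1}\left({q^{-n},q^n,q,\dots,q\atop -q,-q,\dots,-q};q,q\right),$$ where in the ${}_{m+2}\phi_{m+1}$ the upper parameters are $q^{-n},q^n$ followed by $m$ copies of $q$, and the lower parameters are $m+1$ copies of $-q$.
   Context: Put $(x;q)_0=1$, $(x;q)_k=\prod_{i=0}^{k-1}(1-xq^i)$. For a nonnegative integer $n$, the terminating basic hypergeometric series is $${}_{r+1}\phi_r\left({q^{-n},a_2,\dots,a_{r+1}\atop b_1,\dots,b_r};q,z\right)=\sum_{k=0}^n\frac{(q^{-n};q)_k(a_2;q)_k\cdots(a_{r+1};q)_k}{(q;q)_k(b_1;q)_k\cdots(b_r;q)_k}z^k .$$ *)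

(* Defs.v *)
From HB Require Import structures.
From mathcomp Require Import all_boot all_order all_algebra.
From mathcomp Require Import all_classical all_reals all_analysis.
Import Order.TTheory GRing.Theory Num.Theory.
Import numFieldNormedType.Exports.

Set Implicit Arguments.
Unset Strict Implicit.
Unset Printing Implicit Defensive.

Local Open Scope classical_set_scope.
Local Open Scope ring_scope.

Definition qpoch (F : fieldType) (x q : F) (k : nat) : F :=
  \prod_(0 <= i < k) (1 - x * q ^+ i).

(* The terminating series _{r+1}phi_r (q^{-n}, a ; b ; q, z), meant for lists
   of the same length r: [a] holds the upper parameters a_2, ..., a_{r+1}, the
   first upper parameter q^{-n} being given by [n], and [b] the lower ones. *)
Definition qhyper (F : fieldType) (n : nat) (a b : seq F) (q z : F) : F :=
  \sum_(0 <= k < n.+1)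
    (qpoch (q ^- n) q k * \prod_(x <- a) qpoch x q k)
    / (qpoch q q k * \prod_(y <- b) qpoch y q k) * z ^+ k.

(* Both halves are required to converge separately, so that this is not a
   principal value; when they do not, [bilateral_sum] is meaningless. *)
Definition bilateral_cvg (R : realType) (f : int -> R) : Prop :=
  cvgn (series (fun n : nat => f n%:Z)) /\
  cvgn (series (fun n : nat => f (- n.+1%:Z))).

Definition bilateral_sum (R : realType) (f : int -> R) : R :=
  limn (series (fun n : nat => f n%:Z)) +
  limn (series (fun n : nat => f (- n.+1%:Z))).

(* Main.v *)
Require Import Defs.
From mathcomp Require Import all_boot all_order all_algebra.
From mathcomp Require Import all_classical all_reals all_analysis.
From mathcomp Require Import ring lra.
Import Order.TTheory GRing.Theory Num.Theory.
Import numFieldNormedType.Exports.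

Local Open Scope classical_set_scope.
Local Open Scope ring_scope.

(** Write (x)_k for (x;q)_k.  The double sum over n and over the index k of the
    hypergeometric series is not absolutely convergent, so the two summations
    cannot be exchanged in the limit.  They can be exchanged in the partial
    sums over n <= N, where for fixed k the sum over n telescopes
    ([gosper_diff]): for arbitrary coefficients c_k with c_0 = 1,
      1 + sum_(1 <= n <= N) (-1)^n (1 + q^n) q^C(n,2)
            sum_k (q^-n)_k (q^n)_k c_k q^k
        = sum_(k <= N) (-1)^(N-k) q^C(N-k+1,2) (q)_(N+k) / (q)_(N-k) c_k
    ([telescoped], [gosperE]).  For the coefficients
    c_k = (q)_k^m / ((q)_k (-q)_k^(m+1)) of the theorem, the k-th summand on
    the right is w_(N,k) t_(N,k), where
      w_(N,k) = (-1)^(N-k) q^C(N-k+1,2) / ((q)_(N-k) (q)_k),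
      t_(N,k) = (q)_(N+k) / (q)_k * ((q)_k / (-q)_k)^(m+1).
    The weights w_(N,k) sum to 1 over k by the q-binomial theorem at z = 1
    ([weight_sum]) and are O(q^(N-k)), so they concentrate near k = N, where
    t_(N,k) is close to D^(m+1) with D = lim (q)_k / (-q)_k.  Hence the partial
    sums tend to D^(m+1) ([toeplitz], [gosper_sum_cvg]).

    It remains to identify D with the theta series (Gauss).  This is the case
    m = 0 of the same limit: the q-Chu-Vandermonde formula evaluates the 2phi1
    and turns the n-th term into 2 (-1)^n q^(n^2) ([qhyper21_square]), so that
    the partial sums are those of the theta series. *)

(** * Identities for q-shifted factorials *)

Section Pochhammer.
Context {F : fieldType}.
Implicit Types (q x : F).

Lemma qpoch0 x q : qpoch x q 0 = 1.
Proof. by rewrite /qpoch big_geq. Qed.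

Lemma qpochSr x q k : qpoch x q k.+1 = qpoch x q k * (1 - x * q ^+ k).
Proof. by rewrite /qpoch big_nat_recr. Qed.

Lemma qpochSl x q k : qpoch x q k.+1 = (1 - x) * qpoch (x * q) q k.
Proof.
rewrite /qpoch big_nat_recl //= expr0 mulr1; congr (_ * _).
by apply: eq_bigr => i _; rewrite exprS mulrA.
Qed.

Lemma qpochD x q j k :
  qpoch x q (j + k) = qpoch x q j * qpoch (x * q ^+ j) q k.
Proof.
elim: k => [|k IH]; first by rewrite addn0 qpoch0 mulr1.
by rewrite addnS !qpochSr IH exprD; ring.
Qed.

Lemma qpoch_eq0 q n k : q != 0 -> (n < k)%N -> qpoch (q ^- n) q k = 0.
Proof.
move=> q0 nk; rewrite -(subnKC nk) qpochD qpochSr mulVf ?expf_neq0 //.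
by rewrite subrr mulr0 mul0r.
Qed.

Lemma qpoch_neq0 x q k :
  (forall i, 1 - x * q ^+ i != 0) -> qpoch x q k != 0.
Proof.
move=> h; elim: k => [|k IH]; first by rewrite qpoch0 oner_neq0.
by rewrite qpochSr mulf_neq0.
Qed.

Lemma qpoch_step q n k : q != 0 ->
  qpoch (q ^- n.+1) q k.+1 = (1 - (q ^+ n * q)^-1) * qpoch (q ^- n) q k.
Proof.
move=> q0; rewrite qpochSl; congr ((1 - _) * qpoch _ _ _).
  by rewrite exprSr.
by rewrite exprSr invfM -mulrA mulVf ?mulr1.
Qed.

(** The difference (q^-(n+1))_(k+1) - (q^-n)_(k+1) equals
    - q^-(n+1) (1 - q^(k+1)) (q^-n)_k, and the factor 1 - q^(k+1) cancels
    against (q)_(k+1).  This recurrence in n, valid for any coefficients u,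
    gives both the q-binomial theorem and the q-Chu-Vandermonde sum by
    induction. *)
Lemma qpoch_contiguity q (u : nat -> F) n : q != 0 ->
    (forall i, 1 - q * q ^+ i != 0) ->
  \sum_(0 <= k < n.+2) qpoch (q ^- n.+1) q k / qpoch q q k * u k =
  \sum_(0 <= k < n.+1) qpoch (q ^- n) q k / qpoch q q k * u k -
  q ^- n.+1 * \sum_(0 <= k < n.+1) qpoch (q ^- n) q k / qpoch q q k * u k.+1.
Proof.
move=> q0 hq.
have -> : \sum_(0 <= k < n.+1) qpoch (q ^- n) q k / qpoch q q k * u k =
    \sum_(0 <= k < n.+2) qpoch (q ^- n) q k / qpoch q q k * u k.
  by rewrite [RHS]big_nat_recr //= qpoch_eq0 // !mul0r addr0.
rewrite !(big_nat_recl n.+1) //= !qpoch0 -addrA; congr (_ + _).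
rewrite big_distrr -sumrB; apply: eq_bigr => k _ /=.
rewrite qpoch_step // !qpochSr exprSr.
have P0 := qpoch_neq0 q q k hq; have := hq k.
have x0 : q ^+ n != 0 by rewrite expf_neq0.
move: (qpoch q q k) (qpoch _ q k) (q ^+ n) (q ^+ k) x0 P0 => P A x y x0 P0 hk.
by field; rewrite q0 x0 P0 hk.
Qed.

Lemma qbinomial_at1 q n : q != 0 -> (forall i, 1 - q * q ^+ i != 0) ->
  \sum_(0 <= k < n.+1) qpoch (q ^- n) q k / qpoch q q k = qpoch (q ^- n) q n.
Proof.
move=> q0 hq; elim: n => [|n IH].
  by rewrite big_nat1 !qpoch0 divr1.
under eq_bigr do rewrite -[_ / _]mulr1.
rewrite (qpoch_contiguity q (fun _ => 1)) //.
under eq_bigr do rewrite mulr1.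
by rewrite IH qpoch_step // -exprSr; ring.
Qed.

(** The product form avoids dividing by b; for b nonzero its numerator is the
    usual (c/b)_n b^n. *)
Lemma qChuVandermonde q b c n : q != 0 ->
    (forall i, 1 - q * q ^+ i != 0) -> (forall i, 1 - c * q ^+ i != 0) ->
  qhyper n [:: b] [:: c] q q =
  \prod_(0 <= i < n) (b - c * q ^+ i) / qpoch c q n.
Proof.
move=> q0 hq hc.
have -> : qhyper n [:: b] [:: c] q q =
  \sum_(0 <= k < n.+1) qpoch (q ^- n) q k / qpoch q q k *
     (qpoch b q k / qpoch c q k * q ^+ k).
  apply: eq_bigr => k _; rewrite !big_seq1 invfM.
  by rewrite [LHS]mulrAC; ring.
elim: n b c hc => [|n IH] b c hc.
  by rewrite big_nat1 big_geq // !qpoch0 !divr1 !mulr1.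
rewrite (qpoch_contiguity q (fun k => qpoch b q k / qpoch c q k * q ^+ k)) //.
have hcq i : 1 - c * q * q ^+ i != 0 by rewrite -mulrA -exprS.
have c1 : 1 - c != 0 by have := hc 0%N; rewrite expr0 mulr1.
have shift k : qpoch b q k.+1 / qpoch c q k.+1 * q ^+ k.+1 =
   (1 - b) / (1 - c) * q * (qpoch (b * q) q k / qpoch (c * q) q k * q ^+ k).
  by rewrite !qpochSl exprS invfM; ring.
under [X in _ - _ * X]eq_bigr do rewrite shift mulrCA.
rewrite -big_distrr /= !IH // big_nat_recr //=.
under [X in _ - _ * (_ * (X / _))]eq_bigr do rewrite mulrAC -mulrBl.
rewrite big_split /= prodr_const_nat subn0.
have -> : qpoch (c * q) q n = qpoch c q n * (1 - c * q ^+ n) / (1 - c).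
  by rewrite -qpochSr qpochSl mulrAC mulfV ?mul1r.
rewrite qpochSr exprSr.
have C0 := qpoch_neq0 c q n hc; have := hc n.
have x0 : q ^+ n != 0 by rewrite expf_neq0.
move: (qpoch c q n) (\prod_(_ <= _ < _) _) (q ^+ n) C0 x0 => P Q x P0 x0 hn.
by field; rewrite q0 x0 P0 c1 hn.
Qed.

(** * Telescoping of the partial sums *)

(** The antidifference in n of (-1)^n (1 + q^n) q^C(n,2) (q^-n)_k (q^n)_k q^k,
    as found by Gosper's algorithm. *)
Definition gosper q n k : F :=
  (-1) ^+ n * q ^+ 'C(n.+1, 2) * qpoch (q ^- n) q k * qpoch (q ^+ n.+1) q k.

(** For k > 0 all three terms are multiples of (q^-n)_(k-1) (q^(n+2))_(k-1), and
    the cofactors agree as rational functions of q, q^n and q^(k-1). *)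
Lemma gosper_diff q n k : q != 0 ->
  gosper q n.+1 k - gosper q n k =
  (-1) ^+ n.+1 * (1 + q ^+ n.+1) * q ^+ 'C(n.+1, 2) *
    (qpoch (q ^- n.+1) q k * qpoch (q ^+ n.+1) q k * q ^+ k).
Proof.
move=> q0; rewrite /gosper binS bin1 exprD [(-1) ^+ n.+1]exprS.
have x0 : q ^+ n != 0 by rewrite expf_neq0.
case: k => [|k]; first by rewrite !qpoch0 exprSr; ring.
rewrite qpoch_step // (qpochSr (q ^- n)) (qpochSr (q ^+ n.+2)).
rewrite (qpochSl (q ^+ n.+1)) -(exprSr q n.+1) (exprSr q n.+1) (exprSr q n).
rewrite (exprSr q k).
move: ((-1) ^+ n) (q ^+ 'C(_, _)) (qpoch (q ^- n) q k) (qpoch _ q k).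
move: (q ^+ n) (q ^+ k) x0 => x y x0 s e A B.
by field; rewrite q0 x0.
Qed.

(** The initial 1 is the summand at N = 0, and the range of k may be widened from
    N to N + 1 before comparing consecutive N because gosper q N (N + 1) = 0. *)
Lemma telescoped q (c : nat -> F) N : q != 0 -> c 0 = 1 ->
  1 + \sum_(1 <= n < N.+1) (-1) ^+ n * (1 + q ^+ n) * q ^+ 'C(n, 2) *
    (\sum_(0 <= k < n.+1) qpoch (q ^- n) q k * qpoch (q ^+ n) q k * c k * q ^+ k)
  = \sum_(0 <= k < N.+1) gosper q N k * c k.
Proof.
move=> q0 c0; elim: N => [|N IH].
  by rewrite big_geq // big_nat1 /gosper !qpoch0 c0 expr0 bin_small // expr0; ring.
rewrite big_nat_recr //= addrA IH.
have -> : \sum_(0 <= k < N.+1) gosper q N k * c k =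
          \sum_(0 <= k < N.+2) gosper q N k * c k.
  rewrite [RHS]big_nat_recr //= [gosper q N N.+1]/gosper qpoch_eq0 //.
  by rewrite mulr0 !mul0r addr0.
rewrite big_distrr -big_split; apply: eq_bigr => k _ /=.
by have /eqP := gosper_diff q N k q0; rewrite subr_eq => /eqP ->; ring.
Qed.

Lemma qhyperE q m n :
  qhyper n (q ^+ n :: nseq m q) (nseq m.+1 (- q)) q q =
  \sum_(0 <= k < n.+1) qpoch (q ^- n) q k * qpoch (q ^+ n) q k *
     (qpoch q q k ^+ m / (qpoch q q k * qpoch (- q) q k ^+ m.+1)) * q ^+ k.
Proof.
apply: eq_bigr => k _.
by rewrite big_cons !big_nseq !iter_mulr_1 -!mulrA.
Qed.

Lemma prod_exp_rev q n : \prod_(0 <= i < n) q ^+ (n - i) = q ^+ 'C(n.+1, 2).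
Proof.
rewrite big_nat_rev /=; under eq_big_nat => i /andP[_ i_n].
  rewrite add0n subKn //; over.
elim: n => [|n IH]; first by rewrite big_geq // bin_small // expr0.
by rewrite big_nat_recr //= IH -exprD (binS n.+1) bin1.
Qed.

(** Write n for the n.+1 of the statement.  Chu-Vandermonde gives the product of
    the q^n + q^(i+1) over i < n, divided by (-q)_n; taking q^(n-i) out of the i-th factor from the end leaves
    q^C(n+1,2) * 2 (-q)_(n-1), and C(n,2) + C(n+1,2) = n^2. *)
Lemma qhyper21_square q n : q != 0 ->
    (forall i, 1 - q * q ^+ i != 0) -> (forall i, 1 + q * q ^+ i != 0) ->
  (1 + q ^+ n.+1) * q ^+ 'C(n.+1, 2) * qhyper n.+1 [:: q ^+ n.+1] [:: - q] q q =
  2 * q ^+ (n.+1 ^ 2).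
Proof.
move=> q0 hq hq'.
have hc i : 1 - - q * q ^+ i != 0 by rewrite mulNr opprK.
rewrite qChuVandermonde //.
have -> : \prod_(0 <= i < n.+1) (q ^+ n.+1 - - q * q ^+ i) =
   q ^+ 'C(n.+2, 2) * (2 * qpoch (- q) q n).
  have -> : 2 * qpoch (- q) q n = \prod_(0 <= i < n.+1) (1 + q ^+ i).
    rewrite big_nat_recl //= expr0 /qpoch; congr (_ * _).
    by apply: eq_bigr => i _; rewrite mulNr opprK exprS.
  rewrite -prod_exp_rev -big_split big_nat_rev /=.
  apply: eq_big_nat => i /andP[_ i_n].
  rewrite mulrDr mulr1 -exprD subnK 1?ltnW // addrC mulNr opprK -exprS.
  by rewrite add0n subSS subSn.
rewrite qpochSr mulNr opprK -exprS.
have P0 := qpoch_neq0 (- q) q n hc; have := hq' n; rewrite -exprS => h.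
have -> : (n.+1 ^ 2 = 'C(n.+1, 2) + 'C(n.+2, 2))%N.
  by rewrite (binS n.+1) bin1 addnA addnn bin2 halfK oddM andNb subn0 -mulnSr.
rewrite exprD.
move: (qpoch _ q n) (q ^+ n.+1) (q ^+ _) (q ^+ _) P0 h => P x y z P0 h.
by field; rewrite P0 h.
Qed.

(** Each factor of (q^-N)_k is turned round by
    - q^(N-i) (1 - q^(i-N)) = 1 - q^(N-i), where N = j + k. *)
Lemma qpoch_reflect q j k : q != 0 ->
  (-1) ^+ (j + k) * q ^+ 'C((j + k).+1, 2) * qpoch (q ^- (j + k)) q k * qpoch q q j
  = (-1) ^+ j * q ^+ 'C(j.+1, 2) * qpoch q q (j + k).
Proof.
move=> q0; elim: k => [|k IH]; first by rewrite addn0 qpoch0 mulr1.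
rewrite addnS qpoch_step // qpochSr (binS (j + k).+1) bin1 exprD.
rewrite [(-1) ^+ (j + k).+1]exprS [RHS]mulrA -IH exprSr.
have x0 : q ^+ (j + k) != 0 by rewrite expf_neq0.
move: (q ^+ (j + k)) (qpoch _ q k) x0 => x A x0.
by field; rewrite q0 x0.
Qed.

Lemma gosperE q N k : q != 0 -> (forall i, 1 - q * q ^+ i != 0) -> (k <= N)%N ->
  gosper q N k =
  (-1) ^+ (N - k) * q ^+ 'C((N - k).+1, 2) * qpoch q q (N + k) / qpoch q q (N - k).
Proof.
move=> q0 hq kN; have P0 i := qpoch_neq0 q q i hq.
apply: (canRL (mulfK (P0 _))); rewrite /gosper mulrAC.
rewrite -{1 2 3}(subnK kN) qpoch_reflect // subnK //.
by rewrite -[LHS]mulrA (exprS q N) -qpochD.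
Qed.

(** By [qpoch_reflect] the k-th summand is a multiple, independent of k, of
    (q^-N)_k / (q)_k, which reduces the sum to the q-binomial theorem. *)
Lemma weight_sum q N : q != 0 -> (forall i, 1 - q * q ^+ i != 0) ->
  \sum_(0 <= k < N.+1)
    (-1) ^+ (N - k) * q ^+ 'C((N - k).+1, 2) / (qpoch q q (N - k) * qpoch q q k)
  = 1.
Proof.
move=> q0 hq; have P0 i := qpoch_neq0 q q i hq.
under eq_big_nat => k /andP[_ kN].
  rewrite invfM mulrA.
  have -> : (-1) ^+ (N - k) * q ^+ 'C((N - k).+1, 2) / qpoch q q (N - k) =
     (-1) ^+ N * q ^+ 'C(N.+1, 2) / qpoch q q N * qpoch (q ^- N) q k.
    apply: (canLR (mulfK (P0 _))); rewrite -[RHS]mulrA [RHS]mulrAC.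
    apply: (canRL (mulfK (P0 N))).
    have := qpoch_reflect q (N - k) k q0; rewrite subnK // => <-.
    by rewrite mulrA.
  rewrite -mulrA; over.
have := qpoch_reflect q 0 N q0; rewrite add0n qpoch0 !mulr1 mul1r => h.
rewrite -big_distrr /= qbinomial_at1 // mulrAC h.
by rewrite divff.
Qed.

End Pochhammer.

(** * The limits of the shifted factorials *)

Section Analysis.
Context {R : realType} (q : R) (hq0 : 0 < q) (hq1 : q < 1).

Lemma qfactor i : 0 < q * q ^+ i < 1.
Proof. by rewrite -exprS exprn_gt0 // exprn_ilt1 // ltW. Qed.

Lemma qpoch_gt0 k : 0 < qpoch q q k.
Proof.
elim: k => [|k IH]; first by rewrite qpoch0.
by rewrite qpochSr mulr_gt0 // subr_gt0; case/andP: (qfactor k).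
Qed.

Lemma qpoch_opp_ge1 k : 1 <= qpoch (- q) q k.
Proof.
elim: k => [|k IH]; first by rewrite qpoch0.
rewrite qpochSr mulNr opprK; have /andP[] := qfactor k; nra.
Qed.

Lemma qpoch_nincr j k : (j <= k)%N -> qpoch q q k <= qpoch q q j.
Proof.
move=> jk; apply: (@homo_leq _ (qpoch q q) (fun x y => y <= x)) jk => //.
  by move=> a b c ba ac; apply: le_trans ac ba.
move=> n; rewrite qpochSr; have := qpoch_gt0 n; have /andP[] := qfactor n; nra.
Qed.

(** The infinite product is positive because 1/(1 - x) = 1 + x/(1 - x) is at most
    exp(x/(1 - q)) for 0 < x <= q; taking x = q^(i+1) <= q^i and summing the
    geometric series of the q^i bounds 1/(q)_k by exp((1 - q)^-2). *)
Lemma qpoch_lb : exists2 c : R, 0 < c & forall k, c <= qpoch q q k.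
Proof.
exists (expR (- ((1 - q)^-1 * (1 - q)^-1))); first exact: expR_gt0.
have q10 : 0 < 1 - q by rewrite subr_gt0.
move=> k; apply: (@le_trans _ _
  (expR (- ((1 - q)^-1 * \sum_(0 <= i < k) q ^+ i)))).
  rewrite ler_expR lerN2 ler_wpM2l ?invr_ge0 ?(ltW q10) //.
  have := @geometric_le_lim R k 1 q ler01 hq0.
  rewrite mul1r gtr0_norm // => /(_ hq1) h; apply: le_trans h.
  by rewrite le_eqVlt; apply/orP; left; apply/eqP/eq_bigr => i _ /=; rewrite mul1r.
elim: k => [|k IH]; first by rewrite big_geq // mulr0 oppr0 expR0 qpoch0.
rewrite big_nat_recr //= qpochSr mulrDr opprD expRD.
apply: ler_pM; rewrite ?expR_ge0 //.
have /andP[x0 x1] := qfactor k.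
have y0 : 0 < 1 - q * q ^+ k by rewrite subr_gt0.
rewrite -[leRHS]invrK expRN lef_pV2 ?posrE ?invr_gt0 ?expR_gt0 //.
apply: le_trans (expR_ge1Dx _).
rewrite -(ler_pM2r y0) mulVf ?gt_eqF //.
have : q * q ^+ k <= q by rewrite ger_pMr // exprn_ile1 // ltW.
have : (1 - q)^-1 * (1 - q) = 1 by rewrite mulVf ?gt_eqF.
have : 0 < (1 - q)^-1 by rewrite invr_gt0.
have : 0 < q ^+ k by rewrite exprn_gt0.
have : q ^+ k <= 1 by rewrite exprn_ile1 // ltW.
move: (1 - q)^-1 (q ^+ k) => a x x_le1 x_gt0 a_gt0 aq qx_le.
have ax : a * x - a * x * q = x.
  have -> : a * x - a * x * q = a * (1 - q) * x by ring.
  by rewrite aq mul1r.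
have : 0 <= a * x * (q - q * x) by rewrite mulr_ge0 ?subr_ge0 // mulr_ge0 // ltW.
have : q * x <= x by rewrite ger_pMl // ltW.
lra.
Qed.

Lemma qpoch_cvg :
  exists2 P : R, 0 < P /\ (forall k, P <= qpoch q q k) & qpoch q q @ \oo --> P.
Proof.
have [c c0 hc] := qpoch_lb.
have hc' : cvgn (qpoch q q).
  apply: nonincreasing_is_cvgn => [m n|]; first exact: qpoch_nincr.
  by exists c => _ [k _ <-].
exists (limn (qpoch q q)) => //; split.
  by apply: lt_le_trans c0 _; apply: limr_ge => //; apply: nearW.
by apply: nonincreasing_cvgn_ge => // m n; apply: qpoch_nincr.
Qed.

Definition qratio k : R := qpoch q q k / qpoch (- q) q k.

Lemma qratio_bound k : 0 <= qratio k <= 1.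
Proof.
have P0 := qpoch_gt0 k; have Q1 := qpoch_opp_ge1 k.
rewrite divr_ge0 ?(ltW P0) ?(le_trans ler01) //=.
rewrite ler_pdivrMr ?mul1r ?(lt_le_trans ltr01) //.
by apply: le_trans Q1; rewrite -(qpoch0 q q); exact: qpoch_nincr.
Qed.

(** Each factor (1 - q^(k+1)) / (1 + q^(k+1)) is at most 1, so the sequence
    decreases and is bounded below by 0. *)
Lemma qratio_cvg : cvgn qratio.
Proof.
apply: nonincreasing_is_cvgn => [m n mn|]; last first.
  by exists 0 => _ [k _ <-]; case/andP: (qratio_bound k).
apply: (@homo_leq _ qratio (fun x y => y <= x)) mn => //.
  by move=> a b c ba ac; apply: le_trans ac ba.
move=> k; have /andP[r0 _] := qratio_bound k.
have -> : qratio k.+1 = qratio k * ((1 - q * q ^+ k) / (1 + q * q ^+ k)).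
  by rewrite /qratio !qpochSr mulNr opprK invfM mulrACA.
have /andP[x0 x1] := qfactor k.
rewrite ler_piMr // ler_pdivrMr; lra.
Qed.

End Analysis.

(** * Concentrating averages *)

(** Past an index where e < (1 - q) eps / 2, the bound q^p y + eps / 2 propagates,
    since q (eps / 2) + (1 - q) (eps / 2) = eps / 2. *)
Lemma cvg0_contraction (R : realType) (q : R) (y e : nat -> R) :
  0 <= q -> q < 1 -> (forall n, 0 <= y n) ->
  (forall n, y n.+1 <= q * y n + e n.+1) ->
  e @ \oo --> 0 -> y @ \oo --> 0.
Proof.
move=> q0 q1 y0 hy he; apply/cvgr0Pnorm_lt => eps eps0.
have d0 : 0 < (1 - q) * (eps / 2) by rewrite mulr_gt0 ?subr_gt0 ?divr_gt0.
move/cvgr0Pnorm_lt : he => /(_ _ d0) [M _ hM].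
have step p : y (p + M)%N <= q ^+ p * y M + eps / 2.
  elim: p => [|p IH]; first by rewrite mul1r lerDl divr_ge0 // ltW.
  have := hM (p + M).+1 (leqW (leq_addl _ _)) => /ltr_normlW.
  have := hy (p + M)%N; rewrite addSn exprS; nra.
have : (fun p => q ^+ p * y M) @ \oo --> 0.
  rewrite -[X in _ --> X](mul0r (y M)); apply: cvgMl.
  by apply: cvg_expr; rewrite ger0_norm.
move=> /cvgr0Pnorm_lt /(_ (eps / 2)); rewrite divr_gt0 // => /(_ isT) [K _ hK].
exists (K + M)%N => // n /= Kn.
have Mn : (M <= n)%N by apply: leq_trans Kn; rewrite leq_addl.
rewrite ger0_norm // -(subnK Mn); have := step (n - M)%N.
have := hK (n - M)%N; rewrite /= leq_subRL // addnC => /(_ Kn) /ltr_normlW.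
lra.
Qed.

(** The convolution satisfies y_(n+1) = q y_n + e_(n+1). *)
Lemma cvg0_convolution (R : realType) (q : R) (e : nat -> R) :
  0 <= q -> q < 1 -> (forall n, 0 <= e n) -> e @ \oo --> 0 ->
  (fun n => \sum_(0 <= k < n.+1) q ^+ (n - k) * e k) @ \oo --> 0.
Proof.
move=> q0 q1 e0; apply: (@cvg0_contraction R q) => // [n|n].
  by apply: sumr_ge0 => k _; rewrite mulr_ge0 ?exprn_ge0.
rewrite big_nat_recr //= subnn mul1r big_distrr /= lerD2r.
rewrite le_eqVlt; apply/orP; left; apply/eqP; apply: eq_big_nat => k /andP[_ kn].
by rewrite subSn // exprS mulrA.
Qed.

(** Since the weights sum to 1, the distance to L is at most
    C sum_k q^(N-k) e_k, the convolution of a summable and a null sequence. *)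
Lemma toeplitz (R : realType) (q C L : R) (w t : nat -> nat -> R) (e : nat -> R) :
    0 <= q -> q < 1 ->
    (forall N, \sum_(0 <= k < N.+1) w N k = 1) ->
    (forall N k, (k <= N)%N -> `|w N k| <= C * q ^+ (N - k)) ->
    (forall N k, `|t N k - L| <= e k) -> e @ \oo --> 0 ->
  (fun N => \sum_(0 <= k < N.+1) w N k * t N k) @ \oo --> L.
Proof.
move=> q0 q1 w1 hw ht e_0.
have e0 k : 0 <= e k by apply: le_trans (ht 0%N k).
have conv := cvg0_convolution R q e q0 q1 e0 e_0.
apply/cvgrPdist_lt => eps eps0.
have {}conv : (fun N => C * \sum_(0 <= k < N.+1) q ^+ (N - k) * e k) @ \oo --> 0.
  by rewrite -[X in _ --> X](mulr0 C); apply: cvgMr.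
move/cvgr0Pnorm_lt : conv => /(_ _ eps0) [M _ hM]; exists M => // N /hM /ltr_normlW.
apply: le_lt_trans; rewrite distrC.
rewrite -[X in _ - X]mul1r -(w1 N) big_distrl -sumrB big_distrr /=.
apply: le_trans (ler_norm_sum _ _ _) _; apply: ler_sum_nat => k /andP[_ kN].
by rewrite -mulrBr normrM mulrA ler_pM // hw.
Qed.

(** * The limit of the partial sums *)

Section Limit.
Context {R : realType} (q : R) (hq0 : 0 < q) (hq1 : q < 1).

Let q_neq0 : q != 0. Proof. by rewrite gt_eqF. Qed.

Lemma factor_neq0 i : 1 - q * q ^+ i != 0.
Proof. by rewrite gt_eqF // subr_gt0; case/andP: (qfactor q hq0 hq1 i). Qed.

Lemma factor_opp_neq0 i : 1 + q * q ^+ i != 0.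
Proof. by rewrite gt_eqF // addr_gt0 //; case/andP: (qfactor q hq0 hq1 i). Qed.

(** With P = (q;q)_oo, the weights are at most P^-2 q^(N-k) in absolute value, and
    P/(q)_k <= (q)_(N+k)/(q)_k <= 1 bounds the distance of t_(N,k) from its limit
    by a null sequence e_k that does not depend on N. *)
Lemma gosper_sum_cvg m :
  (fun N => \sum_(0 <= k < N.+1) gosper q N k *
     (qpoch q q k ^+ m / (qpoch q q k * qpoch (- q) q k ^+ m.+1))) @ \oo -->
  limn (qratio q) ^+ m.+1.
Proof.
have [P [P0 hP] cvgP] := qpoch_cvg q hq0 hq1.
set D := limn _.
pose w N k := (-1) ^+ (N - k) * q ^+ 'C((N - k).+1, 2) /
  (qpoch q q (N - k) * qpoch q q k).
pose t N k := qpoch q q (N + k) / qpoch q q k * qratio q k ^+ m.+1.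
pose e k := `|qratio q k ^+ m.+1 - D ^+ m.+1| + (1 - P / qpoch q q k).
have p0 k : qpoch q q k != 0 by rewrite gt_eqF // qpoch_gt0.
have pp0 k : qpoch (- q) q k != 0.
  by apply: qpoch_neq0 => i; rewrite mulNr opprK factor_opp_neq0.
rewrite (_ : (fun N => _) = fun N => \sum_(0 <= k < N.+1) w N k * t N k); last first.
  apply/funext => N; apply: eq_big_nat => k /andP[_ kN].
  rewrite gosperE //; last exact: factor_neq0.
  rewrite /w /t /qratio expr_div_n (exprS (qpoch q q k)).
  by field; rewrite !p0 expf_neq0.
apply: (toeplitz _ q (P^-1 * P^-1) _ w t e) => // [|N|N k kN|N k|].
- exact: ltW.
- by apply: weight_sum => //; exact: factor_neq0.
- rewrite /w normrM normrM normrX normrN1 expr1n mul1r.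
  have pp : 0 < qpoch q q (N - k) * qpoch q q k by rewrite mulr_gt0 ?qpoch_gt0.
  rewrite normfV (gtr0_norm pp) (ger0_norm (exprn_ge0 _ (ltW hq0))) mulrC.
  rewrite ler_pM ?exprn_ge0 ?invr_ge0 ?(ltW hq0) ?(ltW pp) //.
    rewrite -invfM lef_pV2 ?posrE ?mulr_gt0 ?qpoch_gt0 //.
    by rewrite ler_pM // ltW.
  by rewrite ler_wiXn2l ?ltW // binS bin1 leq_addl.
- rewrite /t /e.
  have /andP[r0 r1] := qratio_bound q hq0 hq1 k.
  have : 0 <= qratio q k ^+ m.+1 by rewrite exprn_ge0.
  have : qratio q k ^+ m.+1 <= 1 by rewrite exprn_ile1.
  have pk := qpoch_gt0 q hq0 hq1 k.
  have : qpoch q q (N + k) / qpoch q q k <= 1.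
    by rewrite ler_pdivrMr // mul1r qpoch_nincr // leq_addl.
  have : P / qpoch q q k <= qpoch q q (N + k) / qpoch q q k.
    by rewrite ler_pM2r ?invr_gt0.
  have : 0 <= P / qpoch q q k by rewrite divr_ge0 ?ltW.
  move: (_ / _) (P / _) (D ^+ _) (qratio q k ^+ _) => s p L r p_ge0 ps s1 r1' r0'.
  have := ler_norm (r - L); have := ler_norm (L - r); rewrite (distrC L).
  move: `|r - L| => d h1 h2; rewrite ler_norml; apply/andP; split; nra.
- rewrite -[X in _ --> X](addr0 0); apply: cvgD.
    apply/norm_cvg0P; rewrite -[X in _ --> X](subrr (D ^+ m.+1)).
    apply: cvgB; last exact: cvg_cst.
    apply: (cvg_comp (qratio q) (fun x : R => x ^+ m.+1)).
      exact: qratio_cvg.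
    exact: exprn_continuous.
  rewrite -[X in _ --> X](subrr 1); apply: cvgB; first exact: cvg_cst.
  rewrite -[X in _ --> X](mulfV (lt0r_neq0 P0)); apply: cvgM; first exact: cvg_cst.
  by apply: cvgV => //; rewrite gt_eqF.
Qed.

Lemma rhs_cvg m :
  (fun N => \sum_(1 <= n < N) (-1) ^+ n * (1 + q ^+ n) * q ^+ 'C(n, 2) *
     qhyper n (q ^+ n :: nseq m q) (nseq m.+1 (- q)) q q) @ \oo -->
  limn (qratio q) ^+ m.+1 - 1.
Proof.
rewrite -cvg_shiftS.
have -> : [sequence \sum_(1 <= n < N.+1) (-1) ^+ n * (1 + q ^+ n) * q ^+ 'C(n, 2) *
     qhyper n (q ^+ n :: nseq m q) (nseq m.+1 (- q)) q q]_N =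
  fun N => \sum_(0 <= k < N.+1) gosper q N k *
     (qpoch q q k ^+ m / (qpoch q q k * qpoch (- q) q k ^+ m.+1)) - 1.
  apply/funext => N /=; apply: (canRL (addrK 1)); rewrite addrC -telescoped //.
    congr (1 + _); apply: eq_bigr => n _; congr (_ * _); exact: qhyperE.
  by rewrite !qpoch0 !expr1n mulr1 divr1.
apply: cvgB; [exact: gosper_sum_cvg | exact: cvg_cst].
Qed.

(** The case m = 0 of [rhs_cvg]: it yields the convergence of the theta series
    together with its value, which is Gauss's product formula. *)
Lemma theta_cvg :
  (fun N => \sum_(1 <= n < N) (-1) ^+ n * q ^+ (n ^ 2)) @ \oo -->
  (limn (qratio q) - 1) / 2.
Proof.
have := rhs_cvg 0; rewrite expr1 => h.
rewrite (_ : (fun N => _) = fun N => (\sum_(1 <= n < N)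
  (-1) ^+ n * (1 + q ^+ n) * q ^+ 'C(n, 2) * qhyper n [:: q ^+ n] [:: - q] q q) / 2).
  by apply: cvgMl.
apply/funext => N; rewrite big_distrl; apply: eq_big_nat => -[//|n] _ /=.
rewrite -!mulrA; congr (_ * _); rewrite !mulrA qhyper21_square //.
- by rewrite mulrC mulKf // pnatr_eq0.
- exact: factor_neq0.
- exact: factor_opp_neq0.
Qed.
End Limit.

Theorem proposition3p5 (R : realType) (m : nat) (q : R) (hq0 : 0 < q) (hq1 : q < 1) :
  let theta_term := fun n : int => (-1) ^ n * q ^ (n ^+ 2) in
  let rhs_term := fun n : nat =>
    (-1) ^+ n * (1 + q ^+ n) * q ^+ (n * (n - 1) %/ 2)%N *
    qhyper n (q ^+ n :: nseq m q) (nseq m.+1 (- q)) q q in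
  [/\ bilateral_cvg theta_term,
      cvgn (fun N : nat => \sum_(1 <= n < N) rhs_term n) &
      bilateral_sum theta_term ^+ m.+1 =
      1 + limn (fun N : nat => \sum_(1 <= n < N) rhs_term n)].
Proof.
move=> theta_term rhs_term.
have rhsE : (fun N => \sum_(1 <= n < N) rhs_term n) @ \oo -->
    limn (qratio q) ^+ m.+1 - 1.
  under eq_fun do under eq_bigr do rewrite /rhs_term divn2 subn1 -bin2.
  exact: rhs_cvg.
have thetaE (n : nat) : theta_term n%:Z = (-1) ^+ n * q ^+ (n ^ 2).
  by rewrite /theta_term (_ : n%:Z ^+ 2 = (n ^ 2)%N%:Z) // expr2 -PoszM mulnn.
have thetaN n : theta_term (- n%:Z) = theta_term n%:Z.
  by rewrite /theta_term sqrrN -exprnN -exprVn invrN1 exprnP.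
have negE : series (fun n : nat => theta_term (- n.+1%:Z)) @ \oo -->
    (limn (qratio q) - 1) / 2.
  rewrite (_ : series _ =
    [sequence \sum_(1 <= n < N.+1) (-1) ^+ n * q ^+ (n ^ 2)]_N).
    by rewrite (cvg_shiftS (fun N => _)); exact: theta_cvg.
  apply/funext => N; rewrite /series /= big_add1 /=.
  by apply: eq_bigr => n _; rewrite thetaN thetaE.
have posE : series (fun n : nat => theta_term n%:Z) @ \oo -->
    1 + (limn (qratio q) - 1) / 2.
  (* Shifted by one, the nonnegative half is 1 plus the negative half. *)
  rewrite -cvg_shiftS; rewrite (_ : [sequence _]_n = fun N =>
     1 + series (fun n : nat => theta_term (- n.+1%:Z)) N).
    by apply: cvgD => //; exact: cvg_cst.
  apply/funext => N; rewrite /series /= big_nat_recl //= thetaE mulr1; congr (_ + _).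
  by apply: eq_bigr => n _; rewrite thetaN.
split.
- by split; apply: cvgP; [exact: posE | exact: negE].
- exact: cvgP rhsE.
rewrite /bilateral_sum (cvg_lim _ posE) // (cvg_lim _ negE) // (cvg_lim _ rhsE) //.
rewrite [RHS]addrC subrK; congr (_ ^+ _).
by field.
Qed.
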